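(* Let $\mathcal{D}\subset\mathbb{R}^{d_x}$ be a dataset with authentic data distribution $P_{\mathcal{D}}$, and let $\phi\in\mathbb{R}^{d_x}$ be a data-compliant key (so $\|\phi\|=1$ and $\phi^T x<0$ for all $x\sim P_{\mathcal{D}}$). Let $d_{\max}(\phi):=\max_{x\sim P_{\mathcal{D}}}|\phi^T x|$ and let $\varepsilon>0$. If $\varepsilon\ge 1+d_{\max}(\phi)$, then $\Delta x^*=(1+d_{\max}(\phi))\,\phi$ is a solution (a global minimizer) of the problem $$\min_{\Delta x\in\mathbb{R}^{d_x},\ \|\Delta x\|\le\varepsilon}\ \mathbb{E}_{x\sim P_{\mathcal{D}}}\left[\max\{1-\phi^T(x+\Delta x),\,0\}\right],$$ and $f_\phi(x+\Delta x^* )>0$ for all $x\sim P_{\mathcal{D}}$.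
   Context: $\|\cdot\|$ is the Euclidean ($l_2$) norm. $P_{\mathcal{D}}$ is a probability distribution on $\mathbb{R}^{d_x}$ concentrated on $\mathcal{D}$. ''For all $x\sim P_{\mathcal{D}}$'' and ''$\max_{x\sim P_{\mathcal{D}}}$'' mean that $x$ ranges over the data points $x\in\mathcal{D}$; the maximum defining $d_{\max}(\phi)$ is assumed to exist. A key is a vector $\phi\in\mathbb{R}^{d_x}$ with $\|\phi\|=1$; it is data-compliant if $\phi^T x<0$ for all $x\sim P_{\mathcal{D}}$. The classifier associated with $\phi$ is $f_\phi(x)=\mathrm{sign}(\phi^T x)$, so that $f_\phi(x)>0$ means $\phi^T x>0$. *)

(* Defs.v *)
From HB Require Import structures.
From mathcomp Require Import all_boot all_order all_algebra.
From mathcomp Require Import all_classical all_reals all_analysis.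

Set Implicit Arguments.
Unset Strict Implicit.
Unset Printing Implicit Defensive.

Import Order.TTheory GRing.Theory Num.Theory.
Import numFieldNormedType.Exports.

Local Open Scope classical_set_scope.
Local Open Scope ring_scope.

Definition dotp (R : realType) (d : nat) (u v : 'cV[R]_d) : R :=
  (u^T *m v) 0 0.

(* The library's norm [`|x|] on matrices is the sup norm. *)
Definition l2norm (R : realType) (d : nat) (u : 'cV[R]_d) : R :=
  Num.sqrt (\sum_(i < d) (u i 0) ^+ 2).

(* R^d with its Borel sigma-algebra, generated by the open sets of the product
   topology; convertible to ['cV[R]_d]. *)
Notation borel_cV R d := (g_sigma_algebraType (@open 'cV[R]_d)).

Definition concentrated_on (R : realType) (d : nat)
    (P : probability (borel_cV R d) R) (D : set 'cV[R]_d) : Prop :=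
  {ae P, forall x, D x}.

Definition is_key (R : realType) (d : nat) (phi : 'cV[R]_d) : Prop :=
  l2norm phi = 1.

Definition data_compliant (R : realType) (d : nat) (D : set 'cV[R]_d)
    (phi : 'cV[R]_d) : Prop :=
  forall x, D x -> dotp phi x < 0.

Definition classifier (R : realType) (d : nat) (phi x : 'cV[R]_d) : R :=
  Num.sg (dotp phi x).

Definition is_maximum (R : realType) (A : set R) (m : R) : Prop :=
  A m /\ ubound A m.

Definition hinge_loss (R : realType) (d : nat) (phi x : 'cV[R]_d) : R :=
  Num.max (1 - dotp phi x) 0.

Definition expected_loss (R : realType) (d : nat)
    (P : probability (borel_cV R d) R) (phi dx : 'cV[R]_d) : \bar R :=
  'E_P[fun x : 'cV[R]_d => hinge_loss phi (x + dx)]%E.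

Definition is_global_minimizer (R : realType) (T : Type) (A : set T)
    (F : T -> \bar R) (x : T) : Prop :=
  A x /\ forall y, A y -> (F x <= F y)%E.

(* Main.v *)
(* Every data point has phi^T x >= - dmax, so the shift (1 + dmax) phi, which
   adds 1 + dmax to phi^T x because phi has norm 1, makes the margin at least 1
   on D. The nonnegative hinge loss then vanishes almost surely, and its
   expectation attains the trivial lower bound 0. *)

Require Import Defs.
From HB Require Import structures.
From mathcomp Require Import all_boot all_order all_algebra.
From mathcomp Require Import all_classical all_reals all_analysis.
From mathcomp Require Import measurable_realfun.
Import Order.TTheory GRing.Theory Num.Theory.
Import numFieldNormedType.Exports.
Local Open Scope classical_set_scope.
Local Open Scope ring_scope.

Lemma dotpE (R : realType) (d : nat) (u v : 'cV[R]_d) :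
  dotp u v = \sum_(i < d) u i 0 * v i 0.
Proof. by rewrite /dotp mxE; apply: eq_bigr => i _; rewrite mxE. Qed.

Lemma dotpDr (R : realType) (d : nat) (u v w : 'cV[R]_d) :
  dotp u (v + w) = dotp u v + dotp u w.
Proof. by rewrite /dotp mulmxDr mxE. Qed.

Lemma dotpZr (R : realType) (d : nat) (a : R) (u v : 'cV[R]_d) :
  dotp u (a *: v) = a * dotp u v.
Proof. by rewrite /dotp -scalemxAr mxE. Qed.

Lemma l2norm_dotp (R : realType) (d : nat) (u : 'cV[R]_d) :
  l2norm u = Num.sqrt (dotp u u).
Proof. by rewrite dotpE. Qed.

Lemma l2normZ (R : realType) (d : nat) (a : R) (u : 'cV[R]_d) :
  l2norm (a *: u) = `|a| * l2norm u.
Proof.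
rewrite /l2norm -sqrtr_sqr -sqrtrM ?sqr_ge0// mulr_sumr.
by congr Num.sqrt; apply: eq_bigr => i _; rewrite mxE exprMn.
Qed.

Lemma dotp_key (R : realType) (d : nat) (phi : 'cV[R]_d) :
  is_key phi -> dotp phi phi = 1.
Proof.
rewrite /is_key l2norm_dotp => phi1.
(* [Num.sqrt] sends negative numbers to 0, so nonnegativity is what allows the root to be squared
   away. *)
have phi_ge0 : 0 <= dotp phi phi.
  by rewrite dotpE; apply: sumr_ge0 => i _; rewrite -expr2 sqr_ge0.
by rewrite -(sqr_sqrtr phi_ge0) phi1 expr1n.
Qed.

Lemma continuous_dotp (R : realType) (d : nat) (u : 'cV[R]_d) :
  continuous (dotp u).
Proof.
rewrite (_ : dotp u = fun v => \sum_(i < d) u i 0 * v i 0); last first.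
  by apply/funext => v; rewrite dotpE.
move=> v; apply: (cvg_big add_continuous (nbhs_filter v)) => i _.
by apply: cvgM; [exact: cvg_cst|exact: coord_continuous].
Qed.

(** Open intervals generate the Borel sets of [R], and their preimages under [f] are open, hence
    among the generators of [borel_cV R d]. *)
Lemma continuous_borel_measurable (R : realType) (d : nat) (f : 'cV[R]_d -> R) :
  continuous f -> measurable_fun [set: borel_cV R d] (f : borel_cV R d -> R).
Proof.
move=> /continuousP cf.
apply: (measurability _ (RGenOpens.measurableE R)) => _ [_ [a [b ->]] <-].
rewrite setTI; apply: sub_sigma_algebra; apply: cf; exact: interval_open.
Qed.

Lemma measurable_hinge_loss (R : realType) (d : nat) (phi dx : 'cV[R]_d) :
  measurable_fun [set: borel_cV R d]
    (fun x : borel_cV R d => hinge_loss phi ((x : 'cV[R]_d) + dx)).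
Proof.
apply: measurable_maxr; last exact: measurable_cst.
apply: measurable_funB; first exact: measurable_cst.
(* Linearity turns the translation by [dx] into a real constant, so only [dotp phi] itself has to be
   measurable. *)
rewrite (_ : (fun _ => _) = dotp phi \+ cst (dotp phi dx)); last first.
  by apply/funext => x; rewrite dotpDr.
apply: measurable_funD; last exact: measurable_cst.
apply: continuous_borel_measurable; exact: continuous_dotp.
Qed.

Lemma hinge_loss_ge0 (R : realType) (d : nat) (phi x : 'cV[R]_d) :
  0 <= hinge_loss phi x.
Proof. by rewrite /hinge_loss le_max lexx orbT. Qed.

Lemma expected_loss_ge0 (R : realType) (d : nat)
    (P : probability (borel_cV R d) R) (phi dx : 'cV[R]_d) :
  (0 <= expected_loss P phi dx)%E.
Proof. by apply: expectation_ge0 => x; exact: hinge_loss_ge0. Qed.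

(** A margin of at least 1 makes the hinge loss zero on [D], so the integrand is almost surely equal
    to the zero function. *)
Lemma expected_loss_eq0 (R : realType) (d : nat) (D : set 'cV[R]_d)
    (P : probability (borel_cV R d) R) (phi dx : 'cV[R]_d) :
  concentrated_on P D -> (forall x, D x -> 1 <= dotp phi (x + dx)) ->
  expected_loss P phi dx = 0%E.
Proof.
move=> [N [mN N0 DN]] margin; rewrite /expected_loss unlock.
rewrite (ae_eq_integral (cst 0%E)) ?integral0//.
- by apply/measurable_EFinP; exact: measurable_hinge_loss.
(* The measurable null set [N] covering the complement of [D] also covers the points of nonzero
   loss; [D] itself need not be measurable. *)
- exists N; split=> //; apply: subset_trans DN.
  apply: subsetC => x Dx _ /=; congr EFin.
  by apply/max_idPr; rewrite subr_le0; exact: margin.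
Qed.

Theorem proposition1 (R : realType) (d : nat) (D : set 'cV[R]_d)
    (P : probability (borel_cV R d) R) (phi : 'cV[R]_d) (dmax eps : R)
    (P_on_D : concentrated_on P D)
    (key_phi : is_key phi)
    (compliant_phi : data_compliant D phi)
    (dmaxP : is_maximum [set `|dotp phi x| | x in D] dmax)
    (eps_gt0 : 0 < eps)
    (eps_ge : 1 + dmax <= eps) :
  is_global_minimizer [set dx : 'cV[R]_d | l2norm dx <= eps]
    (expected_loss P phi) ((1 + dmax) *: phi) /\
  forall x, D x -> 0 < classifier phi (x + (1 + dmax) *: phi).
Proof.
case: dmaxP => -[x0 _ dmaxE] dmax_ub.
(* The maximum is attained, so [dmax] is itself an absolute value. *)
have dmax_ge0 : 0 <= dmax by rewrite -dmaxE.
have margin x : D x -> 1 <= dotp phi (x + (1 + dmax) *: phi).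
  move=> Dx; have : `|dotp phi x| <= dmax by apply: dmax_ub; exists x.
  rewrite ler_norml => /andP[ge_dmax _].
  (* The new margin is [1 + (dotp phi x + dmax)], whose bracket is nonnegative by [ge_dmax]. *)
  by rewrite dotpDr dotpZr dotp_key// mulr1 addrCA lerDl -lerBlDr sub0r.
split; last first.
  by move=> x Dx; rewrite /classifier sgr_gt0 (lt_le_trans ltr01)// margin.
split=> [|dx _].
  (* Feasibility: the shift has norm exactly [1 + dmax], which [eps_ge] bounds by [eps]. *)
  by rewrite /= l2normZ key_phi mulr1 ger0_norm// addr_ge0.
by rewrite (expected_loss_eq0 _ _ _ _ _ _ P_on_D margin) expected_loss_ge0.
Qed.
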